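(* Let $\mathbf{A}\in\mathbb{R}^{n\times n}$, $\mathbf{B}\in\mathbb{R}^{n\times m}$, let $N\ge n$ be an integer, let $\Delta\mathbf{x}\in\mathbb{R}^n$, and let $\mathcal{C}_N=[\mathbf{B},\mathbf{A}\mathbf{B},\dots,\mathbf{A}^{N-1}\mathbf{B}]\in\mathbb{R}^{n\times mN}$. The minimum energy control problem $$\min_{\mathbf{u}\in\mathbb{R}^{mN}}\ \tfrac12\|\mathbf{u}\|_2^2\quad\text{subject to}\quad \mathcal{C}_N\mathbf{u}=\Delta\mathbf{x}$$ is infeasible if and only if there exists a vector $\mathbf{y}\in\mathbb{R}^n\setminus\{\mathbf{0}\}$ satisfying the following two conditions. (C1) $\mathbf{y}$ lies in the uncontrollable subspace $\mathcal{V}_{\mathrm{unc}}=\mathrm{Null}(\mathcal{C}_N^\top)$, which is spanned by the generalized left eigenvectors of $\mathbf{A}$ associated with uncontrollable modes, that is, $$\mathbf{y}\in\mathcal{V}_{\mathrm{unc}}=\mathrm{Null}(\mathcal{C}_N^\top)=\mathrm{span}\big\{\mathbf{v}\ \big|\ \exists\,\lambda,k:\ (\mathbf{A}^\top-\lambda\mathbf{I})^k\mathbf{v}=\mathbf{0}\ \text{ and }\ \mathbf{v}^\top\mathcal{C}_N=\mathbf{0}\big\}.$$ (C2) $\mathbf{y}^\top\Delta\mathbf{x}\neq 0$. The equality of $\mathrm{Null}(\mathcal{C}_N^\top)$ with the displayed span is part of the assertion.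
   Context: The setting is the discrete-time linear time-invariant system $\mathbf{x}_{k+1}=\mathbf{A}\mathbf{x}_k+\mathbf{B}\mathbf{u}_k$, $k=0,\dots,N-1$, with $\mathbf{x}_k\in\mathbb{R}^n$, $\mathbf{u}_k\in\mathbb{R}^m$. The target displacement is $\Delta\mathbf{x}=\mathbf{x}_N-\mathbf{A}^N\mathbf{x}_0$ for a given initial state $\mathbf{x}_0$ and desired terminal state $\mathbf{x}_N$ (so $\Delta\mathbf{x}$ is an arbitrary vector of $\mathbb{R}^n$), and $\mathbf{u}=[\mathbf{u}_{N-1}^\top\ \cdots\ \mathbf{u}_0^\top]^\top$. The matrix $\mathbf{A}$ is not assumed diagonalizable. ''Infeasible'' means that no $\mathbf{u}\in\mathbb{R}^{mN}$ satisfies $\mathcal{C}_N\mathbf{u}=\Delta\mathbf{x}$. An eigenvalue $\lambda$ of $\mathbf{A}$ is uncontrollable if there is a nonzero $\mathbf{w}$ with $\mathbf{w}^\top\mathbf{A}=\lambda\mathbf{w}^\top$ and $\mathbf{w}^\top\mathbf{B}=\mathbf{0}$. Convention: eigenvalues and generalized eigenvectors may be complex. In the span formula $\lambda\in\mathbb{C}$, $k\ge1$ is an integer, $\mathbf{v}\in\mathbb{C}^n$, and the span and the null space are taken over $\mathbb{C}$, with $^\top$ the plain (non-conjugate) transpose; $\mathbf{y}\in\mathbb{R}^n$ is regarded as an element of $\mathbb{C}^n$. *)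

(* Defs.v *)
From mathcomp Require Import all_boot all_order all_algebra.
From mathcomp Require Import classical_sets reals.
From mathcomp.real_closed Require Import complex.

Set Implicit Arguments.
Unset Strict Implicit.
Unset Printing Implicit Defensive.

Import Order.TTheory GRing.Theory Num.Theory.

Local Open Scope classical_set_scope.
Local Open Scope ring_scope.
Local Open Scope complex_scope.

Record min_problem (R U : Type) := MinProblem {
  objective : U -> R;
  constraint : U -> Prop
}.

Definition infeasible (R U : Type) (P : min_problem R U) : Prop :=
  ~ exists u : U, constraint P u.

(* The Euclidean norm; the norm that mathcomp-analysis puts on matrices is the
   sup norm. *)
Definition norm2 (R : realType) (d : nat) (u : 'cV[R]_d) : R :=
  Num.sqrt (\sum_(i < d) u i 0 ^+ 2).

(* The block row [B, AB, ..., A^(N-1) B].  Its width, equal to m * N, is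
   kept in the form \sum_(k < N) m that records the block decomposition. *)
Definition ctrb_mx (F : fieldType) (n m N : nat)
    (A : 'M[F]_n) (B : 'M[F]_(n, m)) : 'M[F]_(n, \sum_(k < N) m) :=
  \mxrow_(k < N) (A ^+ k *m B).

(* The unknown u is the stacked input sequence: its k-th block, which is
   multiplied by A^k B, is the input applied at time N - 1 - k. *)
Definition min_energy_problem (R : realType) (n m N : nat)
    (A : 'M[R]_n) (B : 'M[R]_(n, m)) (dx : 'cV[R]_n) :
    min_problem R 'cV[R]_(\sum_(k < N) m) :=
  MinProblem (fun u => 2^-1 * norm2 u ^+ 2)
             (fun u => ctrb_mx N A B *m u = dx).

Definition cplx_mx (R : realType) (p q : nat) (M : 'M[R]_(p, q)) :
    'M[R[i]]_(p, q) :=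
  map_mx (real_complex R) M.

Definition null_space (F : fieldType) (p q : nat) (M : 'M[F]_(p, q)) :
    set 'cV[F]_q :=
  [set v | M *m v = 0].

(* <<X>> is only defined for finite sequences X; the span of an arbitrary set
   is the union of the spans of its finite families. *)
Definition set_span (F : fieldType) (V : vectType F) (S : set V) : set V :=
  [set x | exists2 X : seq V, (forall v, v \in X -> S v) & x \in <<X>>%VS].

Definition uncontrollable_space (R : realType) (n m N : nat)
    (A : 'M[R]_n) (B : 'M[R]_(n, m)) : set 'cV[R[i]]_n :=
  null_space (cplx_mx (ctrb_mx N A B))^T.

Definition uncontrollable_eigenvalue (R : realType) (n m : nat)
    (A : 'M[R]_n) (B : 'M[R]_(n, m)) (lambda : R[i]) : Prop :=
  exists w : 'cV[R[i]]_n,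
    [/\ w != 0,
        w^T *m cplx_mx A = lambda *: w^T
      & w^T *m cplx_mx B = 0].

(* The equation (A^T - lambda I)^k v = 0: a nonzero solution v is a generalized
   left eigenvector of A for the eigenvalue lambda. *)
Definition gen_left_eigen_eq (R : realType) (n : nat) (A : 'M[R]_n)
    (lambda : R[i]) (k : nat) (v : 'cV[R[i]]_n) : Prop :=
  ((cplx_mx A)^T - lambda%:M) ^+ k *m v = 0.

(* Main.v *)
(* By the Cayley-Hamilton theorem and N >= n, the null space W of C_N^T is the set
   of v with B^T p(A^T) v = 0 for every polynomial p, so it is A^T-invariant.
   Over C the primary decomposition of A^T therefore restricts to W, and an
   A^T-invariant chain inside W ends with an eigenvector annihilated by B^T.
   Infeasibility is the Fredholm alternative for C_N u = dx over the reals. *)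
Require Import Defs.
From mathcomp Require Import all_boot all_order all_algebra.
From mathcomp Require Import classical_sets reals.
From mathcomp.real_closed Require Import complex.

Set Implicit Arguments.
Unset Strict Implicit.
Unset Printing Implicit Defensive.

Import Order.TTheory GRing.Theory Num.Theory.

Local Open Scope classical_set_scope.
Local Open Scope ring_scope.
Local Open Scope complex_scope.

Lemma trmxX (F : fieldType) (n k : nat) (A : 'M[F]_n) : (A ^+ k)^T = A^T ^+ k.
Proof.
elim: k => [|k IHk]; first by rewrite !expr0 trmx1.
by rewrite exprSr exprS -IHk -!mulmxE trmx_mul.
Qed.

Lemma map_mxX (F K : fieldType) (f : {rmorphism F -> K}) (n k : nat)
    (A : 'M[F]_n) :
  map_mx f (A ^+ k) = map_mx f A ^+ k.
Proof.
elim: k => [|k IHk]; first by rewrite !expr0 map_mx1.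
by rewrite !exprSr -IHk -!mulmxE map_mxM.
Qed.

(** Used to pass between a real pair and its complexification. *)
Lemma map_ctrb_mx (F K : fieldType) (f : {rmorphism F -> K}) (n m N : nat)
    (A : 'M[F]_n) (B : 'M[F]_(n, m)) :
  map_mx f (ctrb_mx N A B) = ctrb_mx N (map_mx f A) (map_mx f B).
Proof.
have -> : map_mx f (ctrb_mx N A B) = \mxrow_(k < N) map_mx f (A ^+ k *m B).
  by apply/matrixP => i j; rewrite !mxE.
by apply: eq_mxrow => k; rewrite map_mxM map_mxX.
Qed.

Lemma ctrb_mx_kerP (F : fieldType) (n m N : nat) (A : 'M[F]_n)
    (B : 'M[F]_(n, m)) (v : 'cV[F]_n) :
  (ctrb_mx N A B)^T *m v = 0 <->
  forall k, (k < N)%N -> B^T *m (A^T ^+ k *m v) = 0.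
Proof.
have -> : (ctrb_mx N A B)^T *m v = \mxcol_(k < N) (B^T *m (A^T ^+ k *m v)).
  rewrite /ctrb_mx tr_mxrow mxcol_mul; apply: eq_mxcol => k.
  by rewrite trmx_mul trmxX mulmxA.
rewrite -[0](mxcol0 (p_ := fun=> m)) -eq_mxcolP.
split=> [h k ltkN | h k]; [exact: (h (Ordinal ltkN)) | exact: h].
Qed.

(** By Cayley-Hamilton, [p] may be replaced by its remainder modulo the characteristic polynomial.
    The dimension is [n.+1], so the remainder only involves powers up to [n], all below [N]. *)
Lemma ctrb_mx_ker_horner (F : fieldType) (n m N : nat) (A : 'M[F]_n.+1)
    (B : 'M[F]_(n.+1, m)) (v : 'cV[F]_n.+1) (p : {poly F}) :
  (n < N)%N -> (ctrb_mx N A B)^T *m v = 0 ->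
  B^T *m (horner_mx A^T p *m v) = 0.
Proof.
move=> ltnN /ctrb_mx_kerP kerv.
set q := char_poly A^T.
have q_neq0 : q != 0 by rewrite -size_poly_eq0 size_char_poly.
rewrite (divp_eq p q) rmorphD rmorphM /= Cayley_Hamilton mulr0 add0r.
have := ltn_modpN0 p q_neq0; rewrite size_char_poly ltnS => size_r.
rewrite -[p %% q]coefK poly_def rmorph_sum /= mulmx_suml mulmx_sumr big1 // => k _.
rewrite linearZ /= rmorphXn /= horner_mx_X -scalemxAl -scalemxAr kerv ?scaler0 //.
exact: leq_trans (leq_trans (ltn_ord k) size_r) ltnN.
Qed.

Lemma ctrb_mx_ker_stable (F : fieldType) (n m N : nat) (A : 'M[F]_n.+1)
    (B : 'M[F]_(n.+1, m)) (v : 'cV[F]_n.+1) (p : {poly F}) :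
  (n < N)%N -> (ctrb_mx N A B)^T *m v = 0 ->
  (ctrb_mx N A B)^T *m (horner_mx A^T p *m v) = 0.
Proof.
move=> ltnN kerv; apply/ctrb_mx_kerP => k _.
(* Absorbing the power of [A^T] into the polynomial reduces every block to the previous lemma. *)
have -> : A^T ^+ k *m (horner_mx A^T p *m v) = horner_mx A^T ('X^k * p) *m v.
  by rewrite rmorphM rmorphXn /= horner_mx_X -mulmxE mulmxA.
exact: ctrb_mx_ker_horner kerv.
Qed.

Lemma horner_mx_XsubC_exp (F : fieldType) (n k : nat) (M : 'M[F]_n.+1) (a : F) :
  horner_mx M (('X - a%:P) ^+ k) = (M - a%:M) ^+ k.
Proof. by rewrite rmorphXn rmorphB /= horner_mx_X horner_mx_C. Qed.

(* Primary decomposition, one root of [p] at a time: writing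
   [p = q (X - a)^k] with [q.[a] != 0], a Bezout relation splits [v] into a part
   killed by [(M - a)^k] and a part killed by [q]. *)
Lemma gen_eigen_ind (F : closedFieldType) (n : nat) (M : 'M[F]_n.+1)
    (W S : set 'cV[F]_n.+1) :
  (forall p v, W v -> W (horner_mx M p *m v)) ->
  S 0 -> (forall u v, S u -> S v -> S (u + v)) ->
  (forall a k v, W v -> (0 < k)%N -> (M - a%:M) ^+ k *m v = 0 -> S v) ->
  forall (p : {poly F}) (v : 'cV[F]_n.+1),
    p != 0 -> W v -> horner_mx M p *m v = 0 -> S v.
Proof.
move=> stableW S0 SD Seigen p.
(* Induction on a bound for the size of [p], with [v] general: the cofactor [q] will kill a
   different vector. *)
elim: (size p).+1 {-2}p (ltnSn (size p)) => // s IHs {}p.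
rewrite ltnS => size_p v p_neq0 Wv pv0.
have [/size_poly1P [c c_neq0 def_p] | /closed_rootP [a pa0]] :=
  boolP (size p == 1%N).
  move: pv0; rewrite def_p horner_mx_C mul_scalar_mx => /eqP.
  by rewrite scaler_eq0 (negPf c_neq0) => /eqP ->.
have [k [q]] := multiplicity_XsubC p a; rewrite p_neq0 /= => qa def_p.
have k_gt0 : (0 < k)%N.
  (* For [k = 0], [p] would equal [q], which does not vanish at [a]. *)
  case: k def_p => // def_p.
  by move: qa; rewrite -[q]mulr1 -(expr0 ('X - a%:P)) -def_p pa0.
have q_neq0 : q != 0 by apply: contraNneq qa => ->; rewrite root0.
have size_q : (size q < s)%N.
  apply: leq_trans size_p; rewrite def_p size_Mmonic ?monic_exp ?monicXsubC //.
  by rewrite size_exp_XsubC addnS /= -addn1 leq_add2l.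
have cop : coprimep (('X - a%:P) ^+ k) q.
  by rewrite coprimep_expl // coprimep_sym coprimep_XsubC.
have /Bezout_eq1_coprimepP [[r t] /= bez] := cop.
have -> : v = horner_mx M (r * ('X - a%:P) ^+ k) *m v + horner_mx M (t * q) *m v.
  by rewrite -mulmxDl -rmorphD bez rmorph1 mul1mx.
have killp f : horner_mx M (f * p) *m v = 0.
  by rewrite rmorphM /= -mulmxE -mulmxA pv0 mulmx0.
(* Each part already carries one factor of [p]; applying the other yields a multiple of [p], which
   kills [v]. Stability keeps both parts in [W]. *)
apply: SD.
  apply: (IHs q) => //; first exact: stableW.
  rewrite mulmxA mulmxE -rmorphM /= mulrCA -def_p; exact: killp.
apply: (Seigen a k) => //; first exact: stableW.
rewrite -horner_mx_XsubC_exp mulmxA mulmxE -rmorphM /= mulrC -mulrA -def_p.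
exact: killp.
Qed.

Lemma set_span_incl (F : fieldType) (V : vectType F) (S : set V) (v : V) :
  S v -> set_span S v.
Proof.
move=> Sv; exists [:: v]; last by rewrite memv_span ?mem_head.
by move=> w; rewrite inE => /eqP ->.
Qed.

Lemma set_span0 (F : fieldType) (V : vectType F) (S : set V) : set_span S 0.
Proof. by exists [::]; rewrite ?mem0v. Qed.

Lemma set_spanD (F : fieldType) (V : vectType F) (S : set V) (u v : V) :
  set_span S u -> set_span S v -> set_span S (u + v).
Proof.
move=> [X SX uX] [Y SY vY]; exists (X ++ Y); last by rewrite span_cat memv_add.
by move=> w; rewrite mem_cat => /orP [/SX | /SY].
Qed.

Lemma set_span_null_space (F : fieldType) (p q : nat) (M : 'M[F]_(p, q))
    (S : set 'cV[F]_q) :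
  S `<=` null_space M -> set_span S `<=` null_space M.
Proof.
move=> sSM v [X SX /(coord_span (X := in_tuple X)) ->].
rewrite /null_space /= mulmx_sumr big1 // => i _.
by rewrite -scalemxAr (sSM _ (SX _ _)) ?scaler0 // mem_nth.
Qed.

Lemma trmx_mul_eq0 (F : fieldType) (p q : nat) (M : 'M[F]_(p, q)) (v : 'cV[F]_p) :
  M^T *m v = 0 <-> v^T *m M = 0.
Proof.
by split=> /(congr1 trmx); rewrite trmx_mul ?trmxK trmx0.
Qed.

Lemma ctrb_mx_ker_span (F : closedFieldType) (n m N : nat) (A : 'M[F]_n)
    (B : 'M[F]_(n, m)) :
  (n <= N)%N ->
  null_space (ctrb_mx N A B)^T =
    set_span [set v : 'cV[F]_n | exists (a : F) (k : nat),
      [/\ (1 <= k)%N, (A^T - a%:M) ^+ k *m v = 0 & v^T *m ctrb_mx N A B = 0]].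
Proof.
move=> leqnN; apply/seteqP; split; last first.
  by apply: set_span_null_space => v [a [k [_ _ /trmx_mul_eq0]]].
case: n => [|n] in A B leqnN *.
  by move=> v _; rewrite [v]flatmx0; exact: set_span0.
move=> v kerv.
(* The characteristic polynomial of [A^T] kills every vector, so it can start the induction. *)
apply: (@gen_eigen_ind F n A^T (null_space (ctrb_mx N A B)^T) _ _ _ _ _
          (char_poly A^T)) => //.
- by move=> p u; exact: ctrb_mx_ker_stable.
- exact: set_span0.
- by move=> u w; exact: set_spanD.
- move=> a k u keru k_gt0 eigu; apply: set_span_incl; exists a, k.
  by split=> //; apply/trmx_mul_eq0.
- by rewrite -size_poly_eq0 size_char_poly.
- by rewrite Cayley_Hamilton mul0mx.
Qed.

(* The last nonzero vector of the chain [v, (A^T - a) v, (A^T - a)^2 v, ...] is an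
   eigenvector, and it is still annihilated by [B^T]. *)
Lemma ctrb_mx_ker_eigenvector (F : fieldType) (n m N : nat) (A : 'M[F]_n)
    (B : 'M[F]_(n, m)) (v : 'cV[F]_n) (a : F) (k : nat) :
  (n <= N)%N -> v != 0 -> (A^T - a%:M) ^+ k *m v = 0 ->
  (ctrb_mx N A B)^T *m v = 0 ->
  exists w : 'cV[F]_n, [/\ w != 0, A^T *m w = a *: w & B^T *m w = 0].
Proof.
case: n => [|n] in A B v * => leqnN; first by rewrite [v]flatmx0 eqxx.
move=> v_neq0; elim: k => [|k IHk] eigv kerv.
  by move: v_neq0; rewrite -[v]mul1mx -[1%:M](expr0 (A^T - a%:M)) eigv eqxx.
have [eigk | w_neq0] := eqVneq ((A^T - a%:M) ^+ k *m v) 0; first exact: IHk.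
exists ((A^T - a%:M) ^+ k *m v); split=> //; last first.
  (* The chain vector is a polynomial in [A^T] applied to [v]. *)
  rewrite -horner_mx_XsubC_exp; exact: ctrb_mx_ker_horner kerv.
apply/eqP; rewrite -subr_eq0 -mul_scalar_mx -mulmxBl mulmxA mulmxE -exprS.
by rewrite eigv.
Qed.

Lemma fredholm_mx (F : fieldType) (p q : nat) (M : 'M[F]_(p, q)) (b : 'cV[F]_p) :
  (~ exists u : 'cV[F]_q, M *m u = b) <->
  exists y : 'cV[F]_p, M^T *m y = 0 /\ (y^T *m b) 0 0 != 0.
Proof.
split=> [infeas | [y [My0 yb_neq0]] [u Mub]]; last first.
  move: yb_neq0; rewrite -Mub mulmxA.
  by move/trmx_mul_eq0: My0 => ->; rewrite mul0mx mxE eqxx.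
(* [submx] compares row spaces, hence the transposes. *)
have : ~~ (b^T <= M^T)%MS.
  apply/negP => /submxP [D /(congr1 trmx)]; rewrite trmx_mul !trmxK => bM.
  by apply: infeas; exists D^T.
rewrite submxE => /rV0Pn [j bj_neq0].
(* A column of the cokernel on which [b^T] is nonzero is the certificate. *)
exists (col j (cokermx M^T)); split.
  by rewrite colE mulmxA mulmx_coker mul0mx.
have -> : (col j (cokermx M^T))^T *m b = (b^T *m col j (cokermx M^T))^T.
  by rewrite trmx_mul trmxK.
by rewrite colE mulmxA -colE !mxE in bj_neq0 *.
Qed.

Theorem theorem1 (R : realType) (n m N : nat)
    (A : 'M[R]_n) (B : 'M[R]_(n, m)) (dx : 'cV[R]_n) (hN : (n <= N)%N) :
  [/\ (* Null(C_N^T) is the displayed span *)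
      uncontrollable_space N A B =
        set_span [set v : 'cV[R[i]]_n |
          exists (lambda : R[i]) (k : nat),
            [/\ (1 <= k)%N,
                gen_left_eigen_eq A lambda k v
              & v^T *m cplx_mx (ctrb_mx N A B) = 0]],
      (* the nonzero spanning vectors are associated with uncontrollable modes *)
      (forall (v : 'cV[R[i]]_n) (lambda : R[i]) (k : nat),
         v != 0 -> (1 <= k)%N -> gen_left_eigen_eq A lambda k v ->
         v^T *m cplx_mx (ctrb_mx N A B) = 0 ->
         uncontrollable_eigenvalue A B lambda)
    & (* the infeasibility certificate *)
      infeasible (min_energy_problem N A B dx) <->
      exists y : 'cV[R]_n,
        [/\ y != 0,
            uncontrollable_space N A B (cplx_mx y)
          & (y^T *m dx) 0 0 != 0]].
Proof.
rewrite /uncontrollable_space /gen_left_eigen_eq /cplx_mx map_ctrb_mx.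
split.
- exact: ctrb_mx_ker_span.
- move=> v a k v_neq0 _ eigv /trmx_mul_eq0 kerv.
  have [w [w_neq0 Aw Bw]] := ctrb_mx_ker_eigenvector hN v_neq0 eigv kerv.
  exists w; split=> //; last exact/trmx_mul_eq0.
  by apply: trmx_inj; rewrite trmx_mul trmxK Aw linearZ /= trmxK.
(* The embedding of the reals is injective and respects products, so a real [y] may be tested over
   either field. *)
- have kerE (y : 'cV[R]_n) :
      null_space (ctrb_mx N (cplx_mx A) (cplx_mx B))^T (cplx_mx y) <->
      (ctrb_mx N A B)^T *m y = 0.
    rewrite /null_space /cplx_mx -map_ctrb_mx /= map_trmx -map_mxM.
    by split=> [/eqP | ->]; rewrite ?map_mx0 // map_mx_eq0 => /eqP.
  rewrite /infeasible /= fredholm_mx; split=> [[y [kery yb]] | [y [_ /kerE kery yb]]].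
    exists y; split=> //; last exact/kerE.
    (* The certificate is nonzero because its pairing with [dx] is. *)
    by apply: contraNneq yb => ->; rewrite trmx0 mul0mx mxE.
  by exists y.
Qed.
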